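(* Let $\mathfrak{B}$ be a bornology with a closed base $\mathfrak{B}_0$ on a topological space $X$, and let $X$ be a $\mathfrak{B}$-Lindelöf space. The following hold. (1) If $|\mathfrak{B}_0|<\mathrm{cov}(\mathcal{M})$, then $X$ satisfies $S_1(\mathcal{O}_{\mathfrak{B}},\mathcal{O}_{\mathfrak{B}})$. (2) If $|\mathfrak{B}_0|<\mathfrak{d}$, then $X$ satisfies $S_{fin}(\mathcal{O}_{\mathfrak{B}},\mathcal{O}_{\mathfrak{B}})$. (3) If $|\mathfrak{B}_0|<\mathfrak{p}$, then $X$ satisfies $S_1(\mathcal{O}_{\mathfrak{B}},\Gamma_{\mathfrak{B}})$.
   Context: A bornology $\mathfrak{B}$ on $X$ is a family of subsets of $X$ that is closed under taking subsets and finite unions and covers $X$; by standing convention $X\notin\mathfrak{B}$. A base of $\mathfrak{B}$ is a subfamily $\mathfrak{B}_0\subseteq\mathfrak{B}$ such that every $B\in\mathfrak{B}$ is contained in some $B_0\in\mathfrak{B}_0$; it is closed if its members are closed subsets of $X$. $\mathcal{O}_{\mathfrak{B}}$ is the collection of all open $\mathfrak{B}$-covers of $X$: families $\mathcal{U}$ of open subsets of $X$ with $X\notin\mathcal{U}$ such that every $B\in\mathfrak{B}$ is contained in some $U\in\mathcal{U}$. $X$ is $\mathfrak{B}$-Lindelöf if every open $\mathfrak{B}$-cover of $X$ contains a countable subfamily that is a $\mathfrak{B}$-cover of $X$. $\Gamma_{\mathfrak{B}}$ is the collection of all $\gamma_{\mathfrak{B}}$-covers of $X$: infinite covers $\mathcal{U}=\{U_n:n\in\omega\}$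 of $X$ by proper open subsets such that for each $B\in\mathfrak{B}$ there is $n_0\in\omega$ with $B\subseteq U_n$ for all $n\ge n_0$. $S_1(\mathcal{A},\mathcal{B})$ means that for each sequence $\{\mathcal{U}_n:n\in\omega\}$ of elements of $\mathcal{A}$ there are $V_n\in\mathcal{U}_n$ with $\{V_n:n\in\omega\}\in\mathcal{B}$. $S_{fin}(\mathcal{A},\mathcal{B})$ means that for each such sequence there are finite (possibly empty) $\mathcal{V}_n\subseteq\mathcal{U}_n$ with $\bigcup_{n\in\omega}\mathcal{V}_n\in\mathcal{B}$. Cardinals: $\mathrm{cov}(\mathcal{M})$ is the least cardinality of a family of first category (meager) subsets of the real line covering the real line. $\mathfrak{d}$ is the least cardinality of a dominating $D\subseteq\omega^\omega$, i.e. one such that for each $g\in\omega^\omega$ there is $f\in D$ with $g(n)\le f(n)$ for all but finitely many $n$. $\mathfrak{p}$ is the least cardinal $k$ for which the following fails: for every family $\mathcal{C}$ of infinite subsets of $\omega$ with $|\mathcal{C}|\le k$ in which every finite subfamily has infinite intersection, there is an infinite $P\subseteq\omega$ with $P\setminus C$ finite for all $C\in\mathcal{C}$. *)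

(* Defs.v *)
From HB Require Import structures.
From mathcomp Require Import all_boot all_order all_algebra.
From mathcomp Require Import boolp classical_sets functions cardinality reals.
From mathcomp Require Import topology normedtype.
Import numFieldNormedType.Exports.

Set Implicit Arguments.
Unset Strict Implicit.
Unset Printing Implicit Defensive.

Local Open Scope classical_set_scope.
Local Open Scope card_scope.

Definition card_lt T U (A : set T) (B : set U) : Prop :=
  A #<= B /\ ~ (B #<= A).

Notation "A '#<' B" := (card_lt A B)
  (at level 79, format "A  '#<'  B") : card_scope.

Definition is_least_card T (P : set T -> Prop) (K : set T) : Prop :=
  P K /\ forall K' : set T, P K' -> K #<= K'.

(* The least cardinal of a set satisfying P, represented by a set of that
   cardinality. It is attained as soon as P is satisfiable: see
   least_cardP. *)
Definition least_card T (P : set T -> Prop) : set T :=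
  xget set0 [set K | is_least_card P K].

(* Cardinals are well-founded: a maximal set of choice functions that are
   pairwise distinct at every index has a surjective projection. *)
Lemma is_least_card_exists T (P : set T -> Prop) :
  (exists K, P K) -> exists K, is_least_card P K.
Proof.
move=> [K0 PK0].
pose good (Y : set (set T -> T)) :=
  (forall y K, Y y -> P K -> K (y K)) /\
  (forall y z K, Y y -> Y z -> P K -> y K = z K -> y = z).
have [|Y [[Yin Yinj] Ymax]] := @Zorn_bigcup _ good.
  move=> F /= Fgood Ftot; split.
    by move=> y K [A FA Ay] PK; exact: (Fgood A FA).1 _ _ Ay PK.
  move=> y z K [A FA Ay] [B FB Bz] PK yz.
  have [AB|BA] := Ftot A B FA FB.
    exact: (Fgood B FB).2 _ _ _ (AB _ Ay) Bz PK yz.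
  exact: (Fgood A FA).2 _ _ _ Ay (BA _ Bz) PK yz.
have [[K [PK Ksurj]]|nsurj] := pselect (exists K, P K /\
    forall t, K t -> exists2 y, Y y & y K = t).
  exists K; split=> // K' PK'.
  have /choice [g gP] t : exists y, K t -> Y y /\ y K = t.
    have [Kt|nKt] := pselect (K t); last by exists (fun=> t).
    by have [y Yy yK] := Ksurj t Kt; exists y.
  have gfun : set_fun K K' (fun t => g t K').
    by move=> t Kt; exact: Yin (gP t Kt).1 PK'.
  have ginj : set_inj K (fun t => g t K').
    move=> s t; rewrite !inE => Ks Kt gst.
    have [Ygs <-] := gP s Ks; have [Ygt <-] := gP t Kt.
    by rewrite (Yinj _ _ _ Ygs Ygt PK' gst).
  have /injfunPex[f] : exists2 f : T -> T, set_fun K K' f & set_inj K f.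
    by exists (fun t => g t K').
  exact: (inj_card_le f).
have [t0 _] : exists t0, K0 t0.
  apply: contrapT => K0e; apply: nsurj; exists K0; split=> // t K0t.
  by case: K0e; exists t.
have /choice [z zP] K : exists t, P K -> K t /\ forall y, Y y -> y K <> t.
  have [PK|nPK] := pselect (P K); last by exists t0.
  apply: contrapT => nt; apply: nsurj; exists K; split=> // t Kt.
  apply: contrapT => ny; apply: nt; exists t => _; split=> // y Yy yK.
  by apply: ny; exists y.
have nYz : ~ Y z by move=> Yz; exact: (zP K0 PK0).2 Yz erefl.
have /Ymax : Y `<` Y `|` [set z].
  by split=> [y|/(_ z)]; [left|move=> /(_ (or_intror erefl))].
case; split.
  by move=> y K [Yy|->] PK; [exact: Yin Yy PK | exact: (zP K PK).1].
move=> y1 y2 K [Yy1|->] [Yy2|->] PK //.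
- exact: Yinj Yy1 Yy2 PK.
- by move=> /((zP K PK).2 _ Yy1).
- by move=> /esym /((zP K PK).2 _ Yy2).
Qed.

Lemma least_cardP T (P : set T -> Prop) :
  (exists K, P K) -> is_least_card P (least_card P).
Proof. by move=> /is_least_card_exists; exact: xgetPex. Qed.

Definition nowhere_dense (T : topologicalType) (A : set T) : Prop :=
  interior (closure A) = set0.

Definition meager (T : topologicalType) (A : set T) : Prop :=
  exists2 F : nat -> set T,
    (forall n, nowhere_dense (F n)) & A = \bigcup_n F n.

Definition cov_meager (R : realType) : set (set R) :=
  least_card (fun F : set (set R) =>
    (forall A, F A -> meager A) /\ \bigcup_(A in F) A = setT).
Arguments cov_meager R : clear implicits.

Definition dominating (D : set (nat -> nat)) : Prop :=
  forall g : nat -> nat, exists2 f, D f & \forall n \near \oo, (g n <= f n)%N.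

Definition dominating_number : set (nat -> nat) := least_card dominating.

Definition strong_fip (C : set (set nat)) : Prop :=
  forall F : set (set nat), finite_set F -> F `<=` C ->
    infinite_set (\bigcap_(A in F) A).

Definition pseudo_intersection (C : set (set nat)) (P : set nat) : Prop :=
  infinite_set P /\ forall A, C A -> finite_set (P `\` A).

(* The cardinal k is given by a set K of cardinality k. *)
Definition pseudo_intersection_property (K : set (set nat)) : Prop :=
  forall C : set (set nat), C #<= K ->
    (forall A, C A -> infinite_set A) -> strong_fip C ->
    exists P, pseudo_intersection C P.

Definition pseudo_intersection_number : set (set nat) :=
  least_card (fun K => ~ pseudo_intersection_property K).

(* Finite unions include the empty one, so set0 is always a member; with
   ~ Bo setT this forces X to be nonempty. *)
Definition bornology (X : Type) (Bo : set (set X)) : Prop :=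
  [/\ forall A B : set X, A `<=` B -> Bo B -> Bo A,
      forall F : set (set X), finite_set F -> F `<=` Bo ->
        Bo (\bigcup_(A in F) A),
      \bigcup_(A in Bo) A = setT
    & ~ Bo setT].

Definition bornology_base (X : Type) (Bo B0 : set (set X)) : Prop :=
  B0 `<=` Bo /\ forall B, Bo B -> exists2 A, B0 A & B `<=` A.

Definition closed_base (X : topologicalType) (Bo B0 : set (set X)) : Prop :=
  bornology_base Bo B0 /\ forall A, B0 A -> closed A.

Definition open_Bcover (X : topologicalType) (Bo : set (set X)) :
    set (set (set X)) :=
  [set U | [/\ forall V, U V -> open V,
               ~ U setT
             & forall B, Bo B -> exists2 V, U V & B `<=` V]].

Definition B_Lindelof (X : topologicalType) (Bo : set (set X)) : Prop :=
  forall U, open_Bcover Bo U ->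
    exists W, [/\ W `<=` U, countable W & open_Bcover Bo W].

Definition gamma_Bcover (X : topologicalType) (Bo : set (set X)) :
    set (set (set X)) :=
  [set U | [/\ infinite_set U,
               \bigcup_(V in U) V = setT,
               forall V, U V -> open V /\ V <> setT
             & exists2 u : nat -> set X, U = range u &
                 forall B, Bo B -> exists n0, forall n, (n0 <= n)%N ->
                   B `<=` u n]].

Definition S1 (X : Type) (A B : set (set (set X))) : Prop :=
  forall U : nat -> set (set X), (forall n, A (U n)) ->
    exists2 V : nat -> set X, (forall n, U n (V n)) & B (range V).

Definition Sfin (X : Type) (A B : set (set (set X))) : Prop :=
  forall U : nat -> set (set X), (forall n, A (U n)) ->
    exists2 V : nat -> set (set X),
      (forall n, finite_set (V n) /\ V n `<=` U n) & B (\bigcup_n V n).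

(* Main.v *)
Require Import Defs.
From mathcomp Require Import all_boot all_order all_algebra.
From mathcomp Require Import boolp classical_sets functions cardinality reals.
From mathcomp Require Import topology normedtype.
Import Order.TTheory GRing.Theory Num.Theory numFieldNormedType.Exports.

(** The B-Lindelof property turns a sequence of open B-covers into a matrix of
    open sets [W n m], where each [W n] is an open B-cover by members of the
    n-th one. A selection is then a function [g : nat -> nat], choosing
    [W n (g n)], and each of the three properties says that some [g] meets, for
    every [B] in the base, a requirement on the sets
    [Q B n = {m | B is contained in W n m}], which are nonempty. The topology
    plays its part only through this matrix; what remains is combinatorics on
    a family of fewer than cov(M), d or p sequences of subsets of nat.

    - For cov(M), the [g] that miss [Q B n] for all [n] form a nowhere dense
      subset of Baire space. To work with the real line instead, a single map
      [phi] from R to Baire space is built under which all these sets pull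
      back to nowhere dense sets ([ex_generic_coding]); fewer than cov(M) of
      them leave some real [x] uncovered, and [phi x] is the selection
      ([cov_meager_selection]).
    - For d, let [f B n] be a member of [Q B n]. The functions [f B] are too
      few to dominate, so some [g] exceeds each [f B] at some [n], where the
      finite family [{W n m | m < g n}] contains [W n (f B n)]
      ([dominating_number_selection]).
    - For p, [g n] must lie in [Q B n] for almost all [n]. Finite unions of
      members of the bornology stay in it, so finitely many [B] have a common
      selection at every [n]. Consider the finite sequences
      that select well for [B] at all their indices: a pseudo-intersection of
      these sets of sequences, as [B] varies, is a supply of arbitrarily long
      sequences almost all of which are good for any given [B]. The value
      [g n] is the n-th entry of one that is longer than [n]
      ([pseudo_intersection_selection]). A sequence of proper sets that
      eventually contains every member of the bornology is automatically
      infinite ([gamma_Bcover_of_base]). *)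

Local Open Scope classical_set_scope.
Local Open Scope card_scope.

(** The only way in which smallness is used below. A witness [L] would itself
    show that the least cardinal is attained, hence at most that of [K]. *)
Lemma card_lt_is_least_card {T U} {K : set T} {P : set U -> Prop}
    {L : set U} : K #< least_card P -> L #<= K -> ~ P L.
Proof.
move=> [_ lK] LK PL; apply: lK.
have [_ lmin] := least_cardP (ex_intro _ L PL).
exact: card_le_trans (lmin L PL) LK.
Qed.

Lemma finite_set_bounded {T} {F : set T} (h : T -> nat) :
  finite_set F -> exists N, forall t, F t -> (h t < N)%N.
Proof.
move=> /(finite_image h) /finite_seqP[s Fs].
exists (\max_(i <- s) i).+1 => t Ft; rewrite ltnS.
have : [set` s] (h t) by rewrite -Fs; exists t.
by move=> /= hts; exact: leq_bigmax_seq.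
Qed.

Lemma nowhere_dense_open_avoid {T : topologicalType} (A : set T) :
  (forall O : set T, open O -> O !=set0 ->
    exists O' : set T, [/\ open O', O' !=set0, O' `<=` O & O' `&` A = set0]) ->
  nowhere_dense A.
Proof.
move=> H; apply: contrapT => /eqP/set0P O0.
have [O' [oO' [y O'y] sO' dO']] := H _ (@open_interior _ _) O0.
have [z [Az O'z]] : A `&` O' !=set0.
  apply: (interior_subset (sO' y O'y)).
  exact: open_nbhs_nbhs.
by have : (O' `&` A) z by []; rewrite dO'.
Qed.

Lemma meager_nowhere_dense {T : topologicalType} (A : set T) :
  nowhere_dense A -> meager A.
Proof.
by move=> nA; exists (fun=> A); rewrite ?bigcup_const //; exists 0%N.
Qed.

(** [truncn (1 / (x - a))] runs through all large naturals as [x] decreases to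
    [a], and each power of 2 divides infinitely many of them exactly; so the
    2-adic valuation takes every value [m] on open intervals arbitrarily close
    to [a]. *)
Lemma ex_itv_logn_truncn {R : realType} (a e : R) (m : nat) : (0 < e)%R ->
  exists b c : R, [/\ (a < b)%R, (b < c)%R, (c < a + e)%R &
    forall x, (b < x < c)%R -> logn 2 (Num.trunc (x - a)^-1%R) = m].
Proof.
move=> e0.
pose k := Num.trunc e^-1%R.
have := truncnS_gt e^-1%R; rewrite -/k => ke.
pose M := (2 ^ m * k.+1.*2.+1)%N.
(* M has 2-adic valuation m and exceeds 1 / e; the interval is the one on
   which 1 / (x - a) lies strictly between M and M + 1. *)
have kM : (k.+1 <= M)%N.
  rewrite (leq_trans (n := k.+1.*2.+1)) ?leq_pmull ?expn_gt0 //.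
  by rewrite -addnn ltnW// ltnS leq_addr.
have logM : logn 2 M = m.
  by rewrite /M mulnC logn_Gauss ?pfactorK // coprime2n /= odd_double.
have M0 : (0 < M%:R :> R)%R by rewrite ltr0n; exact: leq_trans kM.
exists (a + M.+1%:R^-1)%R, (a + M%:R^-1)%R; split.
- by rewrite ltrDl invr_gt0.
- by rewrite ltrD2l ltf_pV2 ?posrE// ltr_nat.
- rewrite ltrD2l invf_plt ?posrE //; apply: (lt_le_trans ke).
  by rewrite ler_nat.
- move=> x /andP[]; rewrite -ltrBrDl => xa1; rewrite -ltrBlDl => xa2.
  rewrite -[RHS]logM; congr logn; apply: truncn_def.
  have xa0 : (0 < x - a)%R by apply: lt_trans xa1; rewrite invr_gt0.
  rewrite -[X in (X <= _)%R]invrK lef_pV2 ?posrE ?invr_gt0// (ltW xa2)/=.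
  by rewrite invf_plt ?posrE.
Qed.

(** The [n]-th coordinate of [phi x] takes every value arbitrarily close to the
    [n]-th rational. So in any open set, choosing [n] to be the index of a
    rational of that set and [m] in [Q n], there is an interval on which the
    [n]-th coordinate is constantly [m], and which thus avoids the set in
    question. *)
Lemma ex_generic_coding (R : realType) : exists phi : R -> nat -> nat,
  forall Q : nat -> set nat, (forall n, Q n !=set0) ->
    nowhere_dense [set x | forall n, ~ Q n (phi x n)].
Proof.
pose q n : R := ratr (odflt 0%R (unpickle n)).
exists (fun x n => logn 2 (Num.trunc (x - q n)^-1%R)) => Q Q0.
apply: nowhere_dense_open_avoid => O oO On0.
have [a [Oa [r _ ra]]] := dense_rat On0 oO; rewrite -ra in Oa.
have qr : q (pickle r) = ratr r by rewrite /q pickleK.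
have [m Qm] := Q0 (pickle r).
have /nbhs_ballP[e /= e0 eO] : nbhs (ratr r : R) O by exact: open_nbhs_nbhs.
have [b [c [ab bc ce phim]]] := ex_itv_logn_truncn (ratr r) e m e0.
exists `]b, c[%classic; split.
- exact: itv_open.
- by exists ((b + c) / 2%:R)%R; rewrite /= in_itv /= !midf_lt.
- move=> x /=; rewrite in_itv /= => /andP[bx xc]; apply: eO.
  rewrite -ball_normE /= distrC gtr0_norm ?subr_gt0 ?(lt_trans ab)//.
  by rewrite ltrBlDl (lt_trans xc).
- rewrite -subset0 => x [/=]; rewrite in_itv /= => bxc /(_ (pickle r)).
  by rewrite qr phim.
Qed.

(** The reals whose codes miss [Q t] entirely form, for each [t], a nowhere
    dense set; a real outside all of them codes the selection. *)
Lemma cov_meager_selection {T} (R : realType) (K : set T)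
    (Q : T -> nat -> set nat) :
  K #< cov_meager R -> (forall t n, K t -> Q t n !=set0) ->
  exists g : nat -> nat, forall t, K t -> exists n, Q t n (g n).
Proof.
move=> Kcov Q0; have [phi phiP] := ex_generic_coding R.
pose M t : set R := [set x | forall n, ~ Q t n (phi x n)].
apply: contrapT => nog.
apply: (card_lt_is_least_card Kcov (card_image_le M K)); split.
  move=> _ [t Kt <-]; apply/meager_nowhere_dense/phiP => n; exact: Q0.
rewrite -subTset => x _; apply: contrapT => nx; apply: nog; exists (phi x).
move=> t Kt; apply: contrapT => nQ; apply: nx; exists (M t); first by exists t.
by move=> n Qn; apply: nQ; exists n.
Qed.

Lemma dominating_number_selection {T} (K : set T) (f : T -> nat -> nat) :
  K #< dominating_number ->
  exists g : nat -> nat, forall t, K t -> exists n, (f t n < g n)%N.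
Proof.
move=> Kd; apply: contrapT => nog.
apply: (card_lt_is_least_card Kd (card_image_le f K)) => g.
apply: contrapT => ndom; apply: nog; exists g => t Kt.
apply: contrapT => nt; apply: ndom; exists (f t); first by exists t.
apply: nearW => n; rewrite leqNgt; apply/negP => lt_fg.
by apply: nt; exists n.
Qed.

Lemma pseudo_intersection_number_ex {T} {K : set T} {C : set (set nat)} :
  K #< pseudo_intersection_number -> C #<= K -> strong_fip C ->
  exists P, pseudo_intersection C P.
Proof.
move=> Kp CK Cfip; apply: contrapT => nP.
apply: (card_lt_is_least_card Kp CK) => pip.
apply/nP/pip => // A CA.
have := Cfip [set A] (finite_set1 A); rewrite bigcap_set1; apply.
by move=> _ ->.
Qed.

(** Applying the pseudo-intersection property to the pairs [(n, m)] with
    [m] in [Q t n] would give a selection on an infinite set of indices [n]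
    only. Finite sequences repair this: a long sequence settles all smaller
    indices as well. *)
Lemma pseudo_intersection_selection {T} (K : set T)
    (Q : T -> nat -> set nat) :
  K #< pseudo_intersection_number ->
  (forall F : set T, finite_set F -> F `<=` K ->
    forall n, \bigcap_(t in F) Q t n !=set0) ->
  exists g : nat -> nat, forall t, K t ->
    exists n0, forall n, (n0 <= n)%N -> Q t n (g n).
Proof.
move=> Kp Qfip.
(* When K is finite it is itself an admissible F. *)
have [Kfin|Kinf] := pselect (finite_set K).
  have /choice[g gP] := Qfip K Kfin (@subset_refl _ K).
  by exists g => t Kt; exists 0%N => n _; exact: gP.
(* The family must have no more members than K, so the requirement that the
   sequences of P be arbitrarily long cannot come from additional sets; it is
   built into the sets C t through an unbounded function h on K. *)
have /pcard_surjP[h hK] := (infiniteP K).1 Kinf.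
pose C t : set nat := [set c | let s := CodeSeq.decode c in
  (h t <= size s)%N /\ forall i, (i < size s)%N -> Q t i (nth 0%N s i)].
have [P [Pinf PC]] : exists P, pseudo_intersection (C @` K) P.
  apply: (pseudo_intersection_number_ex Kp (card_image_le _ _)) => F Ffin FC.
  have /choice[r rP] (A : set nat) : exists t, F A -> K t /\ C t = A.
    have [/FC[t Kt CtA]|nFA] := pselect (F A); first by exists t.
    by have [t _] := infinite_setN0 Kinf; exists t.
  have /choice[g gP] : forall n, \bigcap_(t in r @` F) Q t n !=set0.
    apply: Qfip; first exact: finite_image.
    by move=> _ [A FA <-]; exact: (rP A FA).1.
  have [N hN] := finite_set_bounded h (finite_image r Ffin).
  (* Initial segments of g of length at least N lie in the intersection. *)
  move=> /(finite_set_bounded (fun c => size (CodeSeq.decode c)))[L hL].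
  have := hL (CodeSeq.code (mkseq g (N + L))).
  rewrite CodeSeq.codeK size_mkseq ltnNge leq_addl => noL.
  apply/notF/noL => A FA.
  rewrite -(rP A FA).2 /C /= CodeSeq.codeK size_mkseq; split.
    by apply: leq_trans (leq_addr _ _); apply/ltnW/hN; exists A.
  by move=> i iNL; rewrite nth_mkseq //; apply: gP; exists A.
have /choice[c cP] n : exists c, P c /\ (n < size (CodeSeq.decode c))%N.
  have [t Kt ht] := hK n.+1 I.
  apply: contrapT => nc; apply: Pinf.
  apply: sub_finite_set (PC (C t) (ex_intro2 _ _ t Kt erefl)).
  move=> c Pc; split=> // -[]; rewrite ht => nlt _; apply: nc; by exists c.
exists (fun n => nth 0%N (CodeSeq.decode (c n)) n) => t Kt.
(* Codes in P of sequences longer than all those in P minus C t are in C t. *)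
have [N hN] := finite_set_bounded (fun a => size (CodeSeq.decode a))
  (PC (C t) (ex_intro2 _ _ t Kt erefl)).
exists N => n Nn; have [Pc nc] := cP n.
have [[_ Qc]|nC] := pselect (C t (c n)); first exact: Qc.
have := hN (c n) (conj Pc nC).
by move=> /(ltn_trans nc); rewrite ltnNge Nn.
Qed.

Lemma bornology0 {X : Type} {Bo : set (set X)} : bornology Bo -> Bo set0.
Proof.
move=> [_ BoU _ _]; have := BoU set0 (finite_set0 _) (@sub0set _ _).
by rewrite bigcup_set0.
Qed.

(** An enumeration of a countable subcover, which may repeat members since the
    subcover may be finite. It is nonempty because it must cover [set0]. *)
Lemma B_Lindelof_enum {X : topologicalType} {Bo : set (set X)}
    {U : set (set X)} : bornology Bo -> B_Lindelof Bo -> open_Bcover Bo U ->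
  exists W : nat -> set X, (forall m, U (W m)) /\
    forall B, Bo B -> exists m, B `<=` W m.
Proof.
move=> born lind cov.
have [W [WU /countable_injP[f finj] [_ _ WB]]] := lind U cov.
have [V0 WV0 _] := WB _ (bornology0 born).
have /choice[w wP] m :
    exists V, W V /\ forall V', W V' -> f V' = m -> V' = V.
  have [[V [WV fV]]|nV] := pselect (exists V, W V /\ f V = m).
    exists V; split=> // V' WV' fV'; apply: finj; rewrite ?inE //.
    by rewrite fV'.
  by exists V0; split=> // V' WV' fV'; case: nV; exists V'.
exists w; split=> [m|B /WB[V WV BV]]; first exact/WU/(wP m).1.
by exists (f V); rewrite -((wP (f V)).2 V WV erefl).
Qed.

Lemma open_Bcover_of_base {X : topologicalType} {Bo B0 W : set (set X)}
    {U : nat -> set (set X)} :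
  bornology_base Bo B0 -> (forall n, open_Bcover Bo (U n)) ->
  W `<=` \bigcup_n U n ->
  (forall B, B0 B -> exists2 V, W V & B `<=` V) -> open_Bcover Bo W.
Proof.
move=> [_ base] cov WU WB; split.
- by move=> V /WU[n _ UV]; have [+ _ _] := cov n; apply.
- by move=> /WU[n _ UV]; have [_ + _] := cov n; apply.
- move=> B /base[A /WB[V WV AV] BA]; exists V => //; exact: subset_trans AV.
Qed.

(** The range is infinite: otherwise, picking a point outside each of its
    members gives a finite set, hence one contained in a member of the
    bornology; it would be included in some [V n], yet it has a point
    outside [V n]. *)
Lemma gamma_Bcover_of_base {X : topologicalType} {Bo B0 : set (set X)}
    {V : nat -> set X} :
  bornology Bo -> bornology_base Bo B0 ->
  (forall n, open (V n) /\ V n <> setT) ->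
  (forall B, B0 B -> exists n0, forall n, (n0 <= n)%N -> B `<=` V n) ->
  gamma_Bcover Bo (range V).
Proof.
move=> [_ BoU BoT _] [_ base] Vop VB0.
have VB B : Bo B -> exists n0, forall n, (n0 <= n)%N -> B `<=` V n.
  move=> /base[A /VB0[n0 n0P] BA]; exists n0 => n n0n.
  exact: subset_trans (n0P n n0n).
have ptB x : exists2 B, Bo B & B x.
  by have : setT x by []; rewrite -BoT => -[B BoB Bx]; exists B.
split=> //; last 1 first.
- by exists V.
- move=> fin.
  have /choice[y yP] (A : set X) : exists x, A <> setT -> ~ A x.
    apply: contrapT => nA; have An x : A x.
      by apply: contrapT => nAx; apply: nA; exists x.
    have Asub : A = setT by rewrite -subTset => x _.
    apply: (Vop 0%N).2; rewrite -subTset => x _; by case: nA; exists x.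
  have /choice[b bP] (A : set X) : exists B, Bo B /\ B (y A).
    by have [B] := ptB (y A); exists B.
  have [|n0 n0P] := VB _ (BoU _ (finite_image b fin) _).
    by move=> _ [A _ <-]; exact: (bP A).1.
  apply: (yP (V n0) (Vop n0).2); apply: (n0P n0 (leqnn _)).
  by exists (b (V n0)); [exists (V n0) => //; exists n0 | exact: (bP _).2].
- rewrite -subTset => x _; have [B /VB[n0 /(_ n0 (leqnn _)) BV] Bx] := ptB x.
  by exists (V n0); [exists n0 | exact: BV].
- by move=> _ [n _ <-].
Qed.

Theorem theorem4p13 (R : realType) (X : topologicalType)
    (Bo B0 : set (set X)) :
  bornology Bo -> closed_base Bo B0 -> B_Lindelof Bo ->
  [/\ B0 #< cov_meager R -> S1 (open_Bcover Bo) (open_Bcover Bo),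
      B0 #< dominating_number -> Sfin (open_Bcover Bo) (open_Bcover Bo)
    & B0 #< pseudo_intersection_number ->
        S1 (open_Bcover Bo) (gamma_Bcover Bo)].
Proof.
move=> born [base _] lind.
have enum U : (forall n, open_Bcover Bo (U n)) ->
    exists W : nat -> nat -> set X, forall n, (forall m, U n (W n m)) /\
      forall B, Bo B -> exists m, B `<=` W n m.
  move=> cov; have /choice[W WP] n := B_Lindelof_enum born lind (cov n).
  by exists W.
have B0Bo := base.1.
split=> [small U cov|small U cov|small U cov]; have [W WP] := enum U cov.
- have [g gP] := cov_meager_selection R B0 (fun B n => [set m | B `<=` W n m])
    small (fun B n B0B => (WP n).2 B (B0Bo B B0B)).
  exists (fun n => W n (g n)) => [n|]; first exact: (WP n).1.
  apply: (open_Bcover_of_base base cov).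
    by move=> _ [n _ <-]; exists n => //; exact: (WP n).1.
  by move=> B /gP[n BW]; exists (W n (g n)).
- have /choice[f fP] B : exists f : nat -> nat, B0 B ->
      forall n, B `<=` W n (f n).
    have [/B0Bo BoB|nB] := pselect (B0 B); last by exists id.
    by have /choice[f fP] n := (WP n).2 B BoB; exists f.
  have [g gP] := dominating_number_selection B0 f small.
  exists (fun n => W n @` `I_(g n)) => [n|].
    by split; [exact: finite_image | move=> _ [m _ <-]; exact: (WP n).1].
  apply: (open_Bcover_of_base base cov).
    by move=> _ [n _ [m _ <-]]; exists n => //; exact: (WP n).1.
  move=> B B0B; have [n fg] := gP B B0B; exists (W n (f B n)); last exact: fP.
  by exists n => //; exists (f B n).
- have [|g gP] := pseudo_intersection_selection B0
    (fun B n => [set m | B `<=` W n m]) small.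
    move=> F Ffin FB0 n; have [_ BoU _ _] := born.
    have [m mP] := (WP n).2 _ (BoU F Ffin (subset_trans FB0 B0Bo)).
    by exists m => B FB; exact: subset_trans (bigcup_sup FB) mP.
  exists (fun n => W n (g n)) => [n|]; first exact: (WP n).1.
  apply: (gamma_Bcover_of_base born base) => [n|//].
  have [Uop UT _] := cov n; have UW := (WP n).1 (g n).
  by split=> [|WT]; [exact: Uop | rewrite WT in UW].
Qed.
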